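(* Let $N=\{1,\dots,n\}$, let $\mathcal{P}\subseteq\mathbb{R}^n$ be a compact set, and let $I\subseteq N$. The set $\mathcal{P}$ is DD-representable with respect to $I$ if and only if it admits a rectangular decomposition with respect to $I$.
   Context: Notation. $x_I$ denotes the coordinates of $x\in\mathbb{R}^n$ indexed by $I$; $\operatorname{proj}$ is coordinate projection; $\operatorname{conv}$ is convex hull; $\dim P$ is the dimension of $\operatorname{conv}(P)$; $\mathcal{X}(P)$ is the set of extreme points of $\operatorname{conv}(P)$ for a bounded set $P$. A function $f:\mathbb{R}^n\to\mathbb{R}$ is convex in $x_I$ if, for any values $\bar x_i\in\mathbb{R}$, $i\in N\setminus I$, its restriction to $\{x\mid x_i=\bar x_i,\ \forall i\in N\setminus I\}$ is convex. Decision diagram (DD). A DD $\mathcal{D}=(\mathcal{U},\mathcal{A},l(\cdot))$ is a finite layered directed acyclic multigraph with node layers $\mathcal{U}_1,\dots,\mathcal{U}_{n+1}$, where $\mathcal{U}_1=\{r\}$ (root) and $\mathcal{U}_{n+1}=\{t\}$ (terminal), and arc layers $\mathcal{A}_1,\dots,\mathcal{A}_n$, where arcs of $\mathcal{A}_i$ go from $\mathcal{U}_i$ to $\mathcal{U}_{i+1}$, with arc labels $l:\mathcal{A}\to\mathbb{R}$. Parallel arcs are allowed, and different arcs leaving a node may have equal labels. Each $r$-$t$ path $(a_1,\dots,a_n)$ encodes the point $(l(a_1),\dots,l(a_n))\in\mathbb{R}^n$; $\operatorname{Sol}(\mathcal{D})$ is the (finite) set of points encoded by all $r$-$t$ paths.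 DD-representability. A compact set $\mathcal{P}\subseteq\mathbb{R}^n$ is DD-representable w.r.t. $I$ if there exists a DD $\mathcal{D}$ such that $\max\{f(x)\mid x\in\mathcal{P}\}=\max\{f(x)\mid x\in\operatorname{Sol}(\mathcal{D})\}$ for every function $f$ that is convex in $x_I$. Rectangular decomposition. $\mathcal{P}$ admits a rectangular decomposition w.r.t. $I$ if there is a finite collection of compact sets $P_I^j$, $j\in J$, such that: (i) $\dim\operatorname{proj}_{x_i}(P_I^j)=0$ for all $i\in N\setminus I$, $j\in J$ (coordinate $x_i$ is fixed); (ii) $\bigcup_{j\in J}\mathcal{X}(P_I^j)\subseteq\mathcal{P}\subseteq\bigcup_{j\in J}P_I^j$; (iii) for each $j\in J$ there is a finite collection of (possibly degenerate) hyper-rectangles $R_j^k=\prod_{i=1}^n[l_i^k,u_i^k]$, $k\in K_j$, with $\operatorname{conv}(P_I^j)=\operatorname{conv}(\bigcup_{k\in K_j}R_j^k)$. *)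

(* Defs.v *)
From HB Require Import structures.
From mathcomp Require Import all_boot all_order all_algebra.
From mathcomp Require Import all_classical all_reals all_analysis.

Set Implicit Arguments.
Unset Strict Implicit.
Unset Printing Implicit Defensive.

Import Order.TTheory GRing.Theory Num.Theory.
Import numFieldNormedType.Exports.

Local Open Scope classical_set_scope.
Local Open Scope ring_scope.

Definition conv_hull (R : realType) (V : lmodType R) (A : set V) : set V :=
  smallest (@convex_set R V) A.

(* [extreme_points A] is the set of extreme points of the hull of [A]. *)
Definition extreme_points (R : realType) (V : lmodType R) (A : set V) : set V :=
  [set x | conv_hull A x /\
    forall (y z : V) (t : R), conv_hull A y -> conv_hull A z ->
      0 < t < 1 -> x = t *: y + (1 - t) *: z -> y = z].

(* The dimension of [A] is that of the direction space [W] of the affine hull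
   of [conv_hull A]; the middle clause says that [W] is the linear span of the
   differences [y - x0]. The empty set has no dimension in [nat]. *)
Definition has_dim (R : realType) (V : vectType R) (A : set V) (d : nat) : Prop :=
  exists (x0 : V) (W : {vspace V}),
    [/\ conv_hull A x0,
        forall W' : {vspace V},
          (forall y, conv_hull A y -> y - x0 \in W') <-> (W <= W')%VS
      & \dim W = d].

Definition coord_proj (R : realType) (n : nat) (i : 'I_n) (A : set 'rV[R]_n) :
  set R^o := [set x ord0 i | x in A].

Definition convex_in (R : realType) (n : nat) (I : {set 'I_n})
    (f : 'rV[R]_n -> R) : Prop :=
  forall xbar : 'rV[R]_n,
    @convex_function R 'rV[R]_n
      [set x : 'rV[R]_n | forall i, i \notin I -> x ord0 i = xbar ord0 i] f.

(* Layers are numbered from 0: nodes in layers 0, ..., n and arcs in layers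
   0, ..., n - 1. Arcs are abstract objects, so parallel arcs and equal labels
   on arcs leaving the same node are allowed. *)
Record dd (R : realType) (n : nat) : Type := DD {
  dd_node : finType;
  dd_arc : finType;
  dd_node_layer : dd_node -> 'I_n.+1;
  dd_arc_layer : dd_arc -> 'I_n;
  dd_tail : dd_arc -> dd_node;
  dd_head : dd_arc -> dd_node;
  dd_label : dd_arc -> R;
  dd_root : dd_node;
  dd_terminal : dd_node;
  dd_root_layer : forall v, dd_node_layer v = ord0 <-> v = dd_root;
  dd_terminal_layer : forall v, dd_node_layer v = ord_max <-> v = dd_terminal;
  dd_tail_layer : forall a, dd_node_layer (dd_tail a) = dd_arc_layer a :> nat;
  dd_head_layer : forall a, dd_node_layer (dd_head a) = (dd_arc_layer a).+1 :> nat
}.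

(* The layer conditions force [p i] to lie in arc layer [i]. *)
Definition rt_path (R : realType) (n : nat) (D : dd R n) (p : 'I_n -> dd_arc D) :
  Prop :=
  [/\ forall i : 'I_n, i = 0%N :> nat -> dd_tail (p i) = dd_root D,
      forall i j : 'I_n, j = i.+1 :> nat -> dd_head (p i) = dd_tail (p j)
    & forall i : 'I_n, i.+1 = n -> dd_head (p i) = dd_terminal D].

Definition Sol (R : realType) (n : nat) (D : dd R n) : set 'rV[R]_n :=
  [set x | exists2 p : 'I_n -> dd_arc D, rt_path p & x = \row_i dd_label (p i)].

Definition is_max (R : realType) (A : set R) (m : R) : Prop :=
  A m /\ ubound A m.

(* Equality of the two maxima: a real is the maximum of [f] over [P] iff it is
   the maximum of [f] over [Sol D]. Since [Sol D] is finite, when it is nonempty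
   this says that both maxima are attained and equal; when it is empty it says
   that no [f] attains a maximum over [P] either, i.e. (take [f] constant) that
   [P] is empty. *)
Definition DD_representable (R : realType) (n : nat) (I : {set 'I_n})
    (P : set 'rV[R]_n) : Prop :=
  exists D : dd R n, forall f : 'rV[R]_n -> R, convex_in I f ->
    forall m : R, is_max (f @` P) m <-> is_max (f @` Sol D) m.

Definition hyper_rect (R : realType) (n : nat) (l u : 'rV[R]_n) :
  set 'rV[R]_n := [set x | forall i, l ord0 i <= x ord0 i <= u ord0 i].

Definition rectangular_decomposition (R : realType) (n : nat) (I : {set 'I_n})
    (P : set 'rV[R]_n) : Prop :=
  exists (J : finType) (PI : J -> set 'rV[R]_n),
    [/\ forall j, compact (PI j),
        forall j i, i \notin I -> has_dim (coord_proj i (PI j)) 0,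
        \bigcup_j extreme_points (PI j) `<=` P,
        P `<=` \bigcup_j PI j
      & forall j, exists (K : finType) (l u : K -> 'rV[R]_n),
          (forall k i, l k ord0 i <= u k ord0 i) /\
          conv_hull (PI j) = conv_hull (\bigcup_k hyper_rect (l k) (u k))].

(* Main.v *)
Require Import Defs.
From mathcomp Require Import all_boot all_order all_algebra.
From mathcomp Require Import all_classical all_reals all_analysis.
From mathcomp Require Import ring lra.

(** A convex function on a convex hull is bounded by its values on the generating
set, and a point outside a compact convex set C is detected by the convex
function setdist C. Everything below is a combination of these two facts, used
slice by slice: a slice is the affine subspace obtained by fixing the coordinates
outside I, and a function is convex in x_I exactly when it is convex on each
slice.

Both maxima in the definition of DD-representability exist and agree as soon as
each of P and Sol D dominates the other for every f convex in x_I, that is, each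
value of f on one set is at most some value on the other (DD_representableP).
Every finite set is moreover of the form Sol D (exists_dd_Sol): give each point
its own root-terminal path. So the theorem characterizes the sets P that are
equivalent, for this mutual domination, to some finite set.

From a rectangular decomposition, replace each rectangle by its finitely many
vertices, so that conv (P_I^j) = conv W_j with W_j finite, and take for Sol D the
union of the W_j. A point of P lies in some conv W_j, hence is dominated
by W_j. Conversely W_j lies in the hull of its extreme points
(conv_hull_extreme_points), and these are the extreme points of conv (P_I^j),
which belong to P by assumption.

From a DD with solution set S, take as pieces the hulls of the intersections of S
with slices; their rectangles are single points. If x in P were outside the hull
C of the points of S in its slice, then 1 + setdist C on that slice, extended
by 0, would exceed at x all its values on S (dominated_mem_conv_hull). If e is an
extreme point of a piece, then e lies in S and not in the hull C of the other
points; the same kind of function is maximal on S at e only, so some p in P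
reaches that maximum, and writing p as a combination of e and a point of C gives
p = e (dominated_extreme_points). *)

Set Implicit Arguments.
Unset Strict Implicit.
Unset Printing Implicit Defensive.

Import Order.TTheory GRing.Theory Num.Theory.
Import numFieldNormedType.Exports.

Local Open Scope classical_set_scope.
Local Open Scope ring_scope.

(** * Convex hulls and extreme points *)

Section ConvexHull.
Context {R : realType} {V : lmodType R}.
Implicit Types (A B C : set V) (v x y z : V).

(** Trades the type of scalars in the unit interval for an explicit real bound,
which linear arithmetic can use. *)
Lemma convex_setP A : convex_set A <->
  forall x y (t : R), A x -> A y -> 0 <= t <= 1 -> A (t *: x + (1 - t) *: y).
Proof.
split=> [cA x y t Ax Ay /andP[t0 t1]|cA x y t /set_mem Ax /set_mem Ay].
  by apply/set_mem/(cA x y (Itv01 t0 t1)); exact: mem_set.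
by apply: mem_set; apply: cA => //; apply/andP; split; [exact: ge0|exact: le1].
Qed.

Lemma convex_functionP A (f : V -> R) : convex_function A f <->
  forall x y (t : R), A x -> A y -> 0 <= t <= 1 ->
    f (t *: x + (1 - t) *: y) <= t * f x + (1 - t) * f y.
Proof.
split=> [cf x y t Ax Ay /andP[t0 t1]|cf t x y /set_mem Ax /set_mem Ay].
  by apply: (cf (Itv01 t0 t1)); exact: mem_set.
by apply: cf => //; apply/andP; split; [exact: ge0|exact: le1].
Qed.

Lemma conv_hull_convex A : convex_set (conv_hull A).
Proof.
apply/convex_setP => x y t Ax Ay t01 C [cC AC].
by move/convex_setP: (cC); apply => //; [exact: Ax|exact: Ay].
Qed.

Lemma conv_hull_comb A x y (t : R) : conv_hull A x -> conv_hull A y ->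
  0 <= t <= 1 -> conv_hull A (t *: x + (1 - t) *: y).
Proof. exact: (convex_setP _).1 (@conv_hull_convex A) x y t. Qed.

Lemma sub_conv_hull A : A `<=` conv_hull A.
Proof. exact: sub_gen_smallest. Qed.

Lemma conv_hull_min A C : convex_set C -> A `<=` C -> conv_hull A `<=` C.
Proof. exact: smallest_sub. Qed.

Lemma conv_hull_id A : convex_set A -> conv_hull A = A.
Proof. exact: smallest_id. Qed.

Lemma sub_conv_hull2 A B : A `<=` conv_hull B -> conv_hull A `<=` conv_hull B.
Proof. by move=> AB; apply: conv_hull_min => //; exact: conv_hull_convex. Qed.

Lemma convex_set0 : convex_set (set0 : set V).
Proof. by apply/convex_setP. Qed.

Lemma convex_set1 v : convex_set [set v].
Proof.
by apply/convex_setP => x y t /= -> -> _; rewrite -scalerDl addrC subrK scale1r.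
Qed.

Lemma conv_hull_nonempty A x : conv_hull A x -> A !=set0.
Proof.
move=> Ax; apply/set0P/eqP => A0; move: Ax.
by rewrite A0 conv_hull_id//; exact: convex_set0.
Qed.

Lemma scale_cancel_comb (a b c : R) x y : a + b = c -> c != 0 ->
  a *: x + b *: y = c *: ((a / c) *: x + (1 - a / c) *: y).
Proof.
move=> abc c0; rewrite scalerDr !scalerA mulrBr mulr1 [c * _]mulrC divfK//.
by rewrite -abc (addrC a b) addrK.
Qed.

(** The segments from v to conv A already form a convex set. This is what makes
induction on a finite generating set work, for compactness as well as for
extreme points. *)
Lemma conv_hull_setU1 v A : A !=set0 ->
  conv_hull (v |` A) =
  [set p.1 *: v + (1 - p.1) *: p.2 |
    p in [set t : R | 0 <= t <= 1] `*` conv_hull A].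
Proof.
move=> [a0 Aa0]; apply/seteqP; split; last first.
  move=> _ [[t y] /= [t01 Ay] <-].
  apply: conv_hull_comb => //.
    by apply: sub_conv_hull; left.
  by apply: sub_conv_hull2 Ay => z Az; apply: sub_conv_hull; right.
apply: conv_hull_min; last first.
  move=> x [->|Ax].
    exists (1, a0) => /=; last by rewrite subrr scale0r addr0 scale1r.
    by split; [rewrite ler01 lexx|exact: sub_conv_hull].
  exists (0, x) => /=; last by rewrite subr0 scale0r add0r scale1r.
  by split; [rewrite ler01 lexx|exact: sub_conv_hull].
apply/convex_setP => _ _ s [[a y] /= [a01 Ay] <-] [[b z] /= [b01 Az] <-] s01.
pose c := s * a + (1 - s) * b.
have eqc : s * (1 - a) + (1 - s) * (1 - b) = 1 - c by rewrite /c; lra.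
have p1 : 0 <= s * (1 - a) by apply: mulr_ge0; lra.
have p2 : 0 <= (1 - s) * (1 - b) by apply: mulr_ge0; lra.
have p3 : 0 <= s * a by apply: mulr_ge0; lra.
have p4 : 0 <= (1 - s) * b by apply: mulr_ge0; lra.
have E : s *: (a *: v + (1 - a) *: y) + (1 - s) *: (b *: v + (1 - b) *: z)
   = c *: v + ((s * (1 - a)) *: y + ((1 - s) * (1 - b)) *: z).
  by rewrite !scalerDr !scalerA addrACA -scalerDl.
rewrite {}E; have [c1|c1] := eqVneq (1 - c) 0.
  have -> : s * (1 - a) = 0 by lra.
  have -> : (1 - s) * (1 - b) = 0 by lra.
  exists (c, y) => /=; last by rewrite c1 !scale0r !addr0.
  by split=> //; rewrite /c; lra.
have c_gt0 : 0 < 1 - c by rewrite lt_neqAle eq_sym c1; lra.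
rewrite (scale_cancel_comb y z eqc c1).
eexists (c, _) => /=; last by reflexivity.
split; first by rewrite /c; lra.
apply: conv_hull_comb => //.
rewrite divr_ge0//=; last by lra.
by rewrite ler_pdivrMr// mul1r; lra.
Qed.

Lemma extreme_points_hull A B :
  conv_hull A = conv_hull B -> extreme_points A = extreme_points B.
Proof. by rewrite /extreme_points => ->. Qed.

(** Removing an extreme point from a convex set leaves it convex, so the hull of
the remaining generators misses x; and x must be a generator, since otherwise no
generator would be removed. *)
Lemma extreme_pointsP A x : extreme_points A x -> A x /\ ~ conv_hull (A `\ x) x.
Proof.
move=> [hAx extx].
have cC : convex_set (conv_hull A `\ x).
  apply/convex_setP => y z t [Ay nyx] [Az nzx] t01; split.
    exact: conv_hull_comb.
  move=> /= eqx; have [t0|t0] := eqVneq t 0.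
    by apply: nzx; rewrite /= -eqx t0 scale0r add0r subr0 scale1r.
  have [t1|t1] := eqVneq t 1.
    by apply: nyx; rewrite /= -eqx t1 scale1r subrr scale0r addr0.
  have yz : y = z.
    apply: (extx y z t) => //.
    by rewrite !lt_neqAle eq_sym t0 t1.
  apply: nyx; rewrite /= -eqx -yz -scalerDl.
  by rewrite addrC subrK scale1r.
have nAx : ~ conv_hull (A `\ x) x.
  have AC : A `\ x `<=` conv_hull A `\ x.
    by move=> z [Az nzx]; split => //; exact: sub_conv_hull.
  by move=> /(conv_hull_min cC AC) -[_]; apply.
split => //; apply: contrapT => nA; apply: nAx.
rewrite (_ : A `\ x = A)//; apply/seteqP; split=> [z []//|z Az].
by split => // zx; apply: nA; rewrite -zx.
Qed.

(** If x lies strictly between y and z in conv A, write y and z as combinations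
of x and of points y', z' in the hull of the other generators, and solve for x:
it is a combination of y' and z'. The coefficient c that one divides by vanishes
only if y = z = x. *)
Lemma conv_hull_nonextreme A x : A x -> ~ extreme_points A x ->
  conv_hull (A `\ x) x.
Proof.
move=> Ax nex.
have [y [z [t [Ay Az t01 xE yz]]]] : exists y z (t : R),
    [/\ conv_hull A y, conv_hull A z, 0 < t < 1,
        x = t *: y + (1 - t) *: z & y != z].
  apply: contrapT => H; apply: nex; split; first exact: sub_conv_hull.
  move=> y z t Ay Az t01 xE; apply/eqP; apply: contrapT => /negP yz.
  by apply: H; exists y, z, t.
have AE : x |` (A `\ x) = A.
  apply/seteqP; split=> [w [->//|[]//]|w Aw].
  by have [->|/eqP wx] := eqVneq w x; [left|right].
have [A0|/set0P A0] := eqVneq (A `\ x) set0.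
  have hA : conv_hull A = [set x].
    by rewrite -AE A0 setU0 conv_hull_id//; exact: convex_set1.
  by move: Ay Az yz; rewrite hA /= => -> ->; rewrite eqxx.
move: Ay Az; rewrite -{1 2}AE conv_hull_setU1//.
move=> [[a y'] /= [a01 Ay'] yE] [[b z'] /= [b01 Az'] zE].
pose c := t * (1 - a) + (1 - t) * (1 - b).
have p1 : 0 <= t * (1 - a) by apply: mulr_ge0; lra.
have p2 : 0 <= (1 - t) * (1 - b) by apply: mulr_ge0; lra.
have xc : c *: x = (t * (1 - a)) *: y' + ((1 - t) * (1 - b)) *: z'.
  have : x = (1 - c) *: x + ((t * (1 - a)) *: y' + ((1 - t) * (1 - b)) *: z').
    rewrite {1}xE -yE -zE !scalerDr !scalerA addrACA -scalerDl.
    by congr (_ *: _ + _); rewrite /c; lra.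
  move/eqP; rewrite addrC -subr_eq scalerBl scale1r opprB addrC subrK.
  by move/eqP.
have [c0|c0] := eqVneq c 0.
  have a1 : a = 1.
    have /eqP : t * (1 - a) = 0 by rewrite /c in c0; lra.
    by rewrite mulf_eq0 => /orP[]/eqP; lra.
  have b1 : b = 1.
    have /eqP : (1 - t) * (1 - b) = 0 by rewrite /c in c0; lra.
    by rewrite mulf_eq0 => /orP[]/eqP; lra.
  move: yz; rewrite -yE -zE a1 b1 subrr !scale0r !addr0 eqxx; done.
have c_gt0 : 0 < c by rewrite lt_neqAle eq_sym c0 /c addr_ge0.
move: xc; rewrite (scale_cancel_comb (c := c))// => /(scalerI c0) xE'.
rewrite {2}xE'; apply: conv_hull_comb => //.
rewrite divr_ge0//=; last by lra.
by rewrite ler_pdivrMr// mul1r /c; lra.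
Qed.

(** Minkowski's theorem for polytopes: discard non-extreme generators one by one;
neither the hull nor its extreme points change. *)
Lemma conv_hull_extreme_points A : finite_set A ->
  conv_hull A `<=` conv_hull (extreme_points A).
Proof.
move=> /finite_seqP[s].
elim: {s}(size s).+1 {-2}s (ltnSn (size s)) A => // m IH s sm A AE.
have [Aext|] := pselect (A `<=` extreme_points A).
  by apply: sub_conv_hull2 => x /Aext; exact: sub_conv_hull.
move=> /existsNP[x /not_implyP[Ax nex]].
have hA : conv_hull A = conv_hull (A `\ x).
  apply/seteqP; split; apply: sub_conv_hull2 => y; last first.
    by move=> [Ay _]; exact: sub_conv_hull.
  move=> Ay; have [->|/eqP yx] := eqVneq y x; first exact: conv_hull_nonextreme.
  by apply: sub_conv_hull; split.
rewrite (extreme_points_hull hA) hA.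
have xs : x \in s by move: Ax; rewrite AE.
apply: (IH [seq y <- s | y != x]).
  rewrite -ltnS; apply: leq_trans sm; rewrite ltnS size_filter.
  rewrite -(count_predC (pred1 x) s) -[X in (X < _)%N]add0n ltn_add2r.
  by rewrite -has_count has_pred1.
apply/seteqP; split=> y /=; rewrite AE /= mem_filter.
  by move=> [-> /eqP ->].
by move=> /andP[/eqP].
Qed.

End ConvexHull.

(** * Compact hulls and the distance to a convex set *)

Section ConvexTopology.
Context {R : realType} {V : normedModType R}.
Implicit Types (A C : set V) (v x y : V).

(** Adding a generator v to A replaces conv A by the continuous image of the
compact set [0, 1] x conv A given by conv_hull_setU1. *)
Lemma compact_conv_hull A : finite_set A -> compact (conv_hull A).
Proof.
move=> /finite_seqP[s ->]; elim: s => [|v s IH].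
  by rewrite set_nil conv_hull_id; [exact: compact0|exact: convex_set0].
have -> : [set` v :: s] = v |` [set` s].
  apply/seteqP; split=> x /=; rewrite inE.
    by move=> /orP[/eqP|]; [left|right].
  by move=> [->|->]; rewrite ?eqxx ?orbT.
have [->|/set0P s0] := eqVneq [set` s] set0.
  by rewrite setU0 conv_hull_id; [exact: compact_set1|exact: convex_set1].
rewrite conv_hull_setU1//; apply: continuous_compact; last first.
  apply: compact_setX => //.
  rewrite (_ : [set t : R | 0 <= t <= 1] = `[0, 1]%classic).
    exact: segment_compact.
  by apply/seteqP; split => t /=; rewrite in_itv.
apply: continuous_subspaceT => -[t y].
apply: (@continuousD _ _ _ (fun p : R * V => p.1 *: v)).
  apply: continuousZr_tmp; exact: cvg_fst.
apply: continuousZ; last exact: cvg_snd.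
by apply: continuousB; [exact: cst_continuous|exact: cvg_fst].
Qed.

(** The infimum of the empty set of reals being 0, setdist set0 is the constant 0,
so that it is convex for empty C as well. *)
Definition setdist C x : R := inf [set `|x - c| | c in C].

Lemma has_lbound_dist C x : has_lbound [set `|x - c| | c in C].
Proof. by exists 0 => _ [c _ <-]. Qed.

Lemma setdist0 x : setdist set0 x = 0.
Proof. by rewrite /setdist image_set0 inf0. Qed.

Lemma setdist_ge0 C x : 0 <= setdist C x.
Proof.
have [->|/set0P[c Cc]] := eqVneq C set0; first by rewrite setdist0.
by apply: lb_le_inf => [|_ [d _ <-]//]; exists `|x - c|, c.
Qed.

Lemma setdist_le C x c : C c -> setdist C x <= `|x - c|.
Proof. by move=> Cc; apply: ge_inf; [exact: has_lbound_dist|exists c]. Qed.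

Lemma setdist_mem C x : C x -> setdist C x = 0.
Proof.
move=> Cx; apply/eqP; rewrite eq_le setdist_ge0 andbT.
by rewrite (le_trans (setdist_le x Cx))// subrr normr0.
Qed.

Lemma setdist_gt0 C x : closed C -> C !=set0 -> ~ C x -> 0 < setdist C x.
Proof.
move=> clC [c Cc] nCx.
have /nbhs_ballP[e /= e0 eC] : nbhs x (~` C).
  by apply: open_nbhs_nbhs; split => //; exact: closed_openC.
apply: (lt_le_trans e0); apply: lb_le_inf; first by exists `|x - c|, c.
move=> _ [d Cd <-]; rewrite leNgt; apply/negP => xd; apply: (eC d) => //.
by rewrite -ball_normE.
Qed.

(** Combining near-optimal points of C for x and for y gives a point of C that is
near-optimal for the combination of x and y. *)
Lemma setdist_convex C : convex_set C -> convex_function setT (setdist C).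
Proof.
move=> /convex_setP cC; apply/convex_functionP => x y t _ _ t01.
have [->|/set0P[c0 Cc0]] := eqVneq C set0; first by rewrite !setdist0; lra.
apply/ler_addgt0Pr => e e0.
have near z : exists2 c, C c & `|z - c| < setdist C z + e.
  have [||_ [c Cc <-] ?] := @inf_adherent R [set `|z - c| | c in C] e => //.
    by split; [exists `|z - c0|, c0|exact: has_lbound_dist].
  by exists c.
have [c Cc xc] := near x; have [d Cd yd] := near y.
apply: le_trans (setdist_le _ (cC c d t Cc Cd t01)) _.
rewrite opprD addrACA -!scalerBr.
apply: le_trans (ler_normD _ _) _; rewrite !normrZ.
rewrite !ger0_norm; [|lra|lra].
have h1 : t * `|x - c| <= t * (setdist C x + e) by apply: ler_wpM2l; lra.
have h2 : (1 - t) * `|y - d| <= (1 - t) * (setdist C y + e).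
  by apply: ler_wpM2l; lra.
by move: h1 h2; rewrite !mulrDr; lra.
Qed.

End ConvexTopology.

(** * Functions that are convex in some of the coordinates *)

Section Slices.
Context {R : realType} {n : nat} (I : {set 'I_n}).
Implicit Types (x y b : 'rV[R]_n) (f g : 'rV[R]_n -> R) (A : set 'rV[R]_n).

Definition slice b : set 'rV[R]_n :=
  [set x | forall i, i \notin I -> x ord0 i = b ord0 i].

Lemma slice_refl b : slice b b. Proof. by []. Qed.

Lemma slice_eq b x : slice b x -> slice x = slice b.
Proof.
by move=> bx; apply/seteqP; split=> y xy i iI; rewrite xy// bx.
Qed.

Lemma slice_convex b : convex_set (slice b).
Proof.
apply/convex_setP => x y t bx bz _ i iI.
by rewrite !mxE bx// bz// -mulrDl addrC subrK mul1r.
Qed.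

(** The points of the slice at which f is at most some value f a, with a in A,
form a convex set (f is convex and the values are totally ordered) that
contains A. *)
Lemma convex_in_conv_hull f A b x : convex_in I f -> A `<=` slice b ->
  conv_hull A x -> exists2 a, A a & f x <= f a.
Proof.
move=> /(_ b) /convex_functionP cf Ab.
have cC : convex_set (slice b `&` [set y | exists2 a, A a & f y <= f a]).
  apply/convex_setP => y z t [by_ [a Aa ya]] [bz [c Ac zc]] t01.
  split; first exact: (convex_setP _).1 (@slice_convex b) y z t by_ bz t01.
  have h := cf _ _ _ by_ bz t01.
  have [ac|/ltW ca] := leP (f a) (f c).
    exists c => //; apply: le_trans h _.
    have : t * f y <= t * f c by apply: ler_wpM2l; lra.
    have : (1 - t) * f z <= (1 - t) * f c by apply: ler_wpM2l; lra.
    by lra.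
  exists a => //; apply: le_trans h _.
  have : t * f y <= t * f a by apply: ler_wpM2l; lra.
  have : (1 - t) * f z <= (1 - t) * f a by apply: ler_wpM2l; lra.
  by lra.
have AC : A `<=` slice b `&` [set y | exists2 a, A a & f y <= f a].
  by move=> a Aa; split; [exact: Ab|exists a].
by move=> /(conv_hull_min cC AC) [].
Qed.

Definition extend0 b g : 'rV[R]_n -> R :=
  fun y => if `[< slice b y >] then g y else 0.

Lemma extend0_in b g y : slice b y -> extend0 b g y = g y.
Proof. by rewrite /extend0; case: asboolP. Qed.

Lemma extend0_out b g y : ~ slice b y -> extend0 b g y = 0.
Proof. by rewrite /extend0; case: asboolP. Qed.

(** A segment inside a slice is either inside the slice of b or disjoint from it,
so the jump between g and 0 is never seen by convexity in x_I. *)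
Lemma convex_in_extend0 b g : convex_function setT g ->
  convex_in I (extend0 b g).
Proof.
move=> /convex_functionP cg b'; apply/convex_functionP => x y t b'x b'y t01.
have b'z := (convex_setP _).1 (@slice_convex b') x y t b'x b'y t01.
have [bb'|nbb'] := pselect (slice b b').
  have bz z : slice b' z -> slice b z by rewrite (slice_eq bb').
  rewrite (extend0_in _ (bz _ b'z)) (extend0_in _ (bz _ b'x)).
  by rewrite (extend0_in _ (bz _ b'y)); apply: cg.
have nb z : slice b' z -> ~ slice b z.
  move=> b'z' bz; apply: nbb'.
  by rewrite -(slice_eq bz) (slice_eq b'z').
by rewrite !extend0_out ?mulr0 ?addr0//; exact: nb.
Qed.

(** In dimension 0 the direction space is trivial, so all points of the projection
agree with its base point. *)
Lemma has_dim0_unique A (i : 'I_n) x y :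
  has_dim (coord_proj i A) 0 -> A x -> A y -> x ord0 i = y ord0 i.
Proof.
move=> [c [W [_ HW dW]]].
have W0 : W = 0%VS by apply/eqP; rewrite -dimv_eq0 dW.
have Ac z : A z -> z ord0 i = c.
  move=> Az; apply/eqP; rewrite -subr_eq0 -memv0 -W0.
  by apply: (HW W).2 => //; apply: sub_conv_hull; exists z.
by move=> /Ac -> /Ac ->.
Qed.

Lemma has_dim_set1 (V : vectType R) (c : V) : has_dim [set c] 0.
Proof.
exists c, 0%VS; rewrite conv_hull_id; last exact: convex_set1.
split=> //; last by rewrite dimv0.
by move=> W'; split=> [_|_ y ->]; [exact: sub0v|rewrite subrr mem0v].
Qed.

End Slices.

(** * Equality of maxima as mutual domination *)

Section Domination.
Context {R : realType} {T : Type}.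
Implicit Types (A B : set T) (f : T -> R).

Definition dominated f A B := forall x, A x -> exists2 y, B y & f x <= f y.

Lemma dominated_is_max f A B : dominated f A B -> dominated f B A ->
  forall m, is_max (f @` A) m -> is_max (f @` B) m.
Proof.
move=> AB BA _ [[x Ax <-] ub].
have ubB y : B y -> f y <= f x.
  by move=> /BA[z Az yz]; apply: le_trans yz (ub _ _); exists z.
have [y By xy] := AB x Ax.
split; last by move=> _ [z Bz <-]; exact: ubB.
by exists y => //; apply/eqP; rewrite eq_le xy ubB.
Qed.

End Domination.

Lemma finite_is_max (R : realType) (T : eqType) (f : T -> R) (A : set T) :
  finite_set A -> A !=set0 -> exists m, is_max (f @` A) m.
Proof.
move=> /finite_seqP[s ->] [x0 /= x0s].
elim: s x0 x0s => // a s IH x0 _.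
have [->|] := eqVneq s [::].
  exists (f a); split; first by exists a => //=; rewrite mem_seq1.
  by move=> _ [y /= + <-]; rewrite inE => /eqP ->.
case: s IH => // b s IH _.
have [|_ [[z /= zs <-] ub]] := IH b; first by rewrite inE eqxx.
have [az|/ltW za] := leP (f a) (f z).
  exists (f z); split; first by exists z => //=; rewrite inE zs orbT.
  move=> _ [y /= + <-]; rewrite inE => /orP[/eqP ->//|ys].
  by apply: ub; exists y.
exists (f a); split; first by exists a => //=; rewrite inE eqxx.
move=> _ [y /= + <-]; rewrite inE => /orP[/eqP ->//|ys].
by apply: le_trans za; apply: ub; exists y.
Qed.

Lemma finite_Sol (R : realType) (n : nat) (D : dd R n) : finite_set (Sol D).
Proof.
apply: (@sub_finite_set _ _
  [set \row_i dd_label (q i) | q in [set: {ffun 'I_n -> dd_arc D}]]).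
  move=> _ [p _ ->]; exists (finfun p) => //.
  by apply/rowP => i; rewrite !mxE ffunE.
exact/finite_image/finite_finset.
Qed.

(** From left to right, finiteness of Sol D provides a maximum of f over Sol D,
which is then also attained on P, and its maximizers dominate. An empty Sol D
forces P to be empty, as a constant function shows. *)
Lemma DD_representableP (R : realType) (n : nat) (I : {set 'I_n})
    (P : set 'rV[R]_n) :
  DD_representable I P <-> exists D : dd R n, forall f, convex_in I f ->
    dominated f P (Sol D) /\ dominated f (Sol D) P.
Proof.
split=> [[D HD]|[D HD]]; exists D => f cf; last first.
  by have [h1 h2] := HD f cf; split; exact: dominated_is_max.
have [S0|/set0P S0] := eqVneq (Sol D) set0.
  have P0 x : ~ P x.
    move=> Px; have c0 : convex_in I (fun=> 0 : R).
      by move=> b; apply/convex_functionP => *; rewrite !mulr0 addr0.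
    have : is_max ((fun=> 0 : R) @` P) 0.
      by split; [exists x|move=> _ [y _ <-]].
    by move=> /(HD _ c0) [[y]]; rewrite S0.
  by split=> x; [move=> /P0|rewrite S0].
have [m mS] := finite_is_max f (finite_Sol D) S0.
have [[p Pp fp] ubP] := (HD f cf m).2 mS.
case: mS => -[s Ss fs] ubS; split.
  by move=> x Px; exists s => //; rewrite fs; apply: ubP; exists x.
by move=> x Sx; exists p => //; rewrite fp; apply: ubS; exists x.
Qed.

(** * A decision diagram for every finite set *)

Section DDOfPoints.
Context {R : realType} {n m : nat} (pt : 'I_m -> 'rV[R]_n).

Definition outer_layer (i : 'I_n.+1) := (i == ord0) || (i == ord_max).

Definition chain_wf (q : option 'I_m * 'I_n.+1) :=
  (q.1 == None) == outer_layer q.2.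

(** A node is a layer together with the index of the point whose path it lies
on. The first and last layers carry no index, which leaves a single root and a
single terminal shared by all paths, even when there is no point at all. *)
Definition chain_node := {q : option 'I_m * 'I_n.+1 | chain_wf q}.

Lemma chain_nodeP (k : 'I_m) (i : 'I_n.+1) :
  chain_wf (if outer_layer i then None else Some k, i).
Proof. by rewrite /chain_wf /=; case: (outer_layer i). Qed.

Lemma outer_nodeP (i : 'I_n.+1) : outer_layer i -> chain_wf (None, i).
Proof. by rewrite /chain_wf /= => ->. Qed.

Lemma outer_root : outer_layer ord0. Proof. by rewrite /outer_layer eqxx. Qed.
Lemma outer_terminal : outer_layer ord_max.
Proof. by rewrite /outer_layer eqxx orbT. Qed.

Definition chain_at k i : chain_node := exist chain_wf _ (chain_nodeP k i).
Definition outer_at i (oi : outer_layer i) : chain_node :=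
  exist chain_wf _ (outer_nodeP oi).

Lemma outer_at_layer (v : chain_node) (i : 'I_n.+1) (oi : outer_layer i) :
  (val v).2 = i <-> v = outer_at oi.
Proof.
split=> [vi|->//]; apply: val_inj; case: v vi => -[c j] /= cj ji.
by move: cj; rewrite /chain_wf /= ji oi => /eqP/eqP ->.
Qed.

Definition chain_tail (a : 'I_m * 'I_n) :=
  chain_at a.1 (widen_ord (leqnSn n) a.2).
Definition chain_head (a : 'I_m * 'I_n) := chain_at a.1 (lift ord0 a.2).

Lemma chain_tail_layer a : (val (chain_tail a)).2 = a.2 :> nat.
Proof. by []. Qed.

Lemma chain_head_layer a : (val (chain_head a)).2 = a.2.+1 :> nat.
Proof. by []. Qed.

Definition chain_dd : dd R n :=
  DD (fun a : 'I_m * 'I_n => pt a.1 ord0 a.2)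
    (fun v => outer_at_layer v outer_root)
    (fun v => outer_at_layer v outer_terminal)
    chain_tail_layer chain_head_layer.

(** A node where one arc ends and another starts is an inner one, hence remembers
its path: this is why a root-terminal path cannot switch between points. *)
Lemma chain_head_tail a b : chain_head a = chain_tail b ->
  a.1 = b.1 /\ b.2 = a.2.+1 :> nat.
Proof.
move=> /(congr1 val) /= [ab il].
have bl : b.2 = a.2.+1 :> nat by rewrite -il.
split=> //; move: ab; rewrite /outer_layer -!val_eqE /= /bump leq0n add1n -bl.
by rewrite (ltn_eqF (ltn_ord b.2)) bl => -[].
Qed.

Lemma Sol_chain_dd : (0 < n)%N -> Sol chain_dd = range pt.
Proof.
move=> n0; apply/seteqP; split=> [_ [p [pr pc _] ->]|_ [k _ <-]]; last first.
  exists (fun i => (k, i)); last by apply/rowP => i; rewrite !mxE.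
  split=> [i i0|i j ji|i iN]; apply: val_inj => /=.
  - by rewrite (_ : widen_ord _ i = ord0)//; apply: val_inj.
  - by rewrite (_ : lift ord0 i = widen_ord (leqnSn n) j)//; apply: val_inj.
  - rewrite (_ : lift ord0 i = ord_max) ?outer_terminal//.
    by apply: val_inj; rewrite /= /bump leq0n add1n.
pose z := Ordinal n0.
have pE j (jn : (j < n)%N) : p (Ordinal jn) = ((p z).1, Ordinal jn).
  elim: j jn => [|j IH] jn.
    have := congr1 (fun v : chain_node => nat_of_ord (val v).2) (pr z erefl).
    rewrite (_ : Ordinal jn = z); last exact: val_inj.
    move=> /= pz0; rewrite [LHS]surjective_pairing; congr pair.
    exact: val_inj.
  have [] := chain_head_tail (pc (Ordinal (ltnW jn)) (Ordinal jn) erefl).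
  rewrite IH /= => -> pj; rewrite [LHS]surjective_pairing; congr pair.
  exact: val_inj.
exists (p z).1 => //; apply/rowP => i; rewrite !mxE.
by case: i => j jn; rewrite pE.
Qed.

End DDOfPoints.

Lemma exists_dd_Sol (R : realType) (n : nat) (S : set 'rV[R]_n) :
  (0 < n)%N -> finite_set S -> exists D : dd R n, Sol D = S.
Proof.
move=> n0 /finite_seqP[s ->].
exists (chain_dd (fun i : 'I_(size s) => nth 0 s i)); rewrite Sol_chain_dd//.
apply/seteqP; split=> [_ [i _ <-]|x /= /(nthP 0)[i si <-]].
  by apply: mem_nth.
by exists (Ordinal si).
Qed.

(** * Rectangles and their vertices *)

Section Rectangles.
Context {R : realType} {n : nat}.
Implicit Types (l u x : 'rV[R]_n).

Definition rect_vertices l u : set 'rV[R]_n :=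
  [set x | forall i, x ord0 i = l ord0 i \/ x ord0 i = u ord0 i].

Lemma finite_rect_vertices l u : finite_set (rect_vertices l u).
Proof.
apply: (@sub_finite_set _ _ [set \row_i (if b i then l ord0 i else u ord0 i)
  | b in [set: {ffun 'I_n -> bool}]]).
  move=> x xv; exists [ffun i => x ord0 i == l ord0 i] => //.
  apply/rowP => i; rewrite mxE ffunE.
  by case: eqP => [->//|]; case: (xv i).
exact/finite_image/finite_finset.
Qed.

Lemma rect_vertices_sub l u : (forall i, l ord0 i <= u ord0 i) ->
  rect_vertices l u `<=` hyper_rect l u.
Proof. by move=> lu x xv i; case: (xv i) => ->; rewrite lexx lu. Qed.

(** Move one coordinate at a time to its two bounds: x is a combination of the
two points so obtained. The induction bounds the number of coordinates that
may lie strictly between the bounds. *)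
Lemma hyper_rect_sub_conv l u :
  hyper_rect l u `<=` conv_hull (rect_vertices l u).
Proof.
have H k x : (k <= n)%N -> hyper_rect l u x ->
    (forall i : 'I_n, (k <= i)%N ->
      x ord0 i = l ord0 i \/ x ord0 i = u ord0 i) ->
    conv_hull (rect_vertices l u) x.
  elim: k x => [|k IH] x kn xr xv.
    by apply: sub_conv_hull => i; exact: xv.
  pose i0 := Ordinal kn.
  have /andP[lx xu] := xr i0.
  pose y c : 'rV[R]_n := \row_i (if i == i0 then c else x ord0 i).
  have yP c : c = l ord0 i0 \/ c = u ord0 i0 ->
      conv_hull (rect_vertices l u) (y c).
    move=> cE; apply: IH; first exact: ltnW.
      move=> i; rewrite mxE; case: eqP => [->|_]; last exact: xr.
      by case: cE => ->; rewrite lexx (le_trans lx xu).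
    move=> i ki; rewrite mxE; case: eqP => [->//|/eqP ii0].
    apply: xv; rewrite ltn_neqAle ki andbT eq_sym.
    by move: ii0; rewrite -val_eqE.
  have [lu|lu] := eqVneq (u ord0 i0) (l ord0 i0).
    have xl : x ord0 i0 = l ord0 i0 by lra.
    rewrite (_ : x = y (l ord0 i0)); first by apply: yP; left.
    by apply/rowP => i; rewrite mxE; case: eqP => // ->.
  have d_gt0 : 0 < u ord0 i0 - l ord0 i0.
    by rewrite subr_gt0 lt_neqAle eq_sym lu (le_trans lx xu).
  pose t := (u ord0 i0 - x ord0 i0) / (u ord0 i0 - l ord0 i0).
  rewrite (_ : x = t *: y (l ord0 i0) + (1 - t) *: y (u ord0 i0)).
    apply: conv_hull_comb; [by apply: yP; left|by apply: yP; right|].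
    rewrite /t divr_ge0/=; [|lra|lra].
    by rewrite ler_pdivrMr// mul1r lerD2l lerN2.
  apply/rowP => i; rewrite !mxE; case: eqP => [->|_].
    by rewrite /t; field; rewrite gt_eqF.
  by rewrite -mulrDl addrC subrK mul1r.
by move=> x xr; apply: (H n) => // i; rewrite leqNgt ltn_ord.
Qed.

(** Only the vertices of the rectangles matter, so a rectangular piece is a
polytope. *)
Lemma conv_hull_rect_finite (K : finType) (l u : K -> 'rV[R]_n) :
  (forall k i, l k ord0 i <= u k ord0 i) ->
  exists2 W, finite_set W &
    conv_hull (\bigcup_k hyper_rect (l k) (u k)) = conv_hull W.
Proof.
move=> lu; exists (\bigcup_k rect_vertices (l k) (u k)).
  apply: bigcup_finite; first exact: finite_finset.
  by move=> k _; exact: finite_rect_vertices.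
apply/seteqP; split; apply: sub_conv_hull2 => x [k _ xk].
  move/hyper_rect_sub_conv: xk.
  by apply: sub_conv_hull2 => y yk; apply: sub_conv_hull; exists k.
by apply: sub_conv_hull; exists k => //; exact: rect_vertices_sub.
Qed.

Lemma hyper_rect_degenerate x : hyper_rect x x = [set x].
Proof.
apply/seteqP; split=> [y yx|_ -> i]; last by rewrite lexx.
by apply/rowP => i; apply/eqP; rewrite eq_le andbC; exact: yx.
Qed.

End Rectangles.

(** * The two implications *)

Section Directions.
Context {R : realType} {n : nat} (I : {set 'I_n}).
Implicit Types (P : set 'rV[R]_n).

Lemma rectangular_decomposition_DD P : (0 < n)%N ->
  rectangular_decomposition I P -> DD_representable I P.
Proof.
move=> n0 [J [PI [_ PIfix PIext PIcov PIrect]]].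
have /choice[W HW] : forall j, exists W : set 'rV[R]_n,
    finite_set W /\ conv_hull (PI j) = conv_hull W.
  move=> j; have [K [l [u [lu ->]]]] := PIrect j.
  by have [W fW ->] := conv_hull_rect_finite lu; exists W.
have [|D SD] := @exists_dd_Sol R n (\bigcup_j W j) n0.
  apply: bigcup_finite; first exact: finite_finset.
  by move=> j _; exact: (HW j).1.
have PIslice j x : PI j x -> conv_hull (PI j) `<=` slice I x.
  move=> xj; apply: conv_hull_min; first exact: slice_convex.
  by move=> y yj i iI; apply: has_dim0_unique (PIfix j i iI) yj xj.
apply/DD_representableP; exists D => f cf; rewrite SD.
split=> [x /PIcov[j _ xj]|w [j _ Wjw]].
  have [W_fin hW] := HW j.
  have [a Wa xa] : exists2 a, W j a & f x <= f a.
    apply: (convex_in_conv_hull (b := x) cf).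
      move=> a Wa; apply: (PIslice j) => //; rewrite hW.
      exact: sub_conv_hull.
    by rewrite -hW; exact: sub_conv_hull.
  by exists a => //; exists j.
have [W_fin hW] := HW j.
have hw : conv_hull (PI j) w by rewrite hW; exact: sub_conv_hull.
have [x0 x0j] := conv_hull_nonempty hw.
have [e ext_e we] : exists2 e, extreme_points (W j) e & f w <= f e.
  apply: (convex_in_conv_hull (b := x0) cf).
    by move=> e [ec _]; apply: (PIslice j) => //; rewrite hW.
  by apply: conv_hull_extreme_points => //; exact: sub_conv_hull.
exists e => //; apply: PIext; exists j => //.
by rewrite (extreme_points_hull hW).
Qed.

Lemma convex_setdist1 (C : set 'rV[R]_n) : convex_set C ->
  convex_function setT (fun y => 1 + setdist C y).
Proof.
move=> /setdist_convex/convex_functionP cC; apply/convex_functionP => x y t.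
by move=> Tx Ty t01; have := cC x y t Tx Ty t01; lra.
Qed.

Lemma finite_conv_hull_closed (A : set 'rV[R]_n) :
  finite_set A -> closed (conv_hull A).
Proof.
move=> fA; apply: compact_closed; first exact: norm_hausdorff.
exact: compact_conv_hull.
Qed.

(** Otherwise 1 + setdist C on the slice of x, extended by 0, is larger at x than
anywhere on S. *)
Lemma dominated_mem_conv_hull P S x : finite_set S ->
  (forall f, convex_in I f -> dominated f P S) ->
  P x -> conv_hull (S `&` slice I x) x.
Proof.
move=> S_fin PS Px; apply: contrapT; set C := conv_hull _ => nCx.
have cC : convex_set C by exact: conv_hull_convex.
have [s Ss] := PS _ (convex_in_extend0 (I := I) x (convex_setdist1 cC)) x Px.
rewrite extend0_in//; have dx := setdist_ge0 C x.
have [xs|nxs] := pselect (slice I x s); last by rewrite extend0_out//; lra.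
have Cs : C s by apply: sub_conv_hull.
rewrite extend0_in// (setdist_mem Cs).
have : 0 < setdist C x.
  apply: setdist_gt0 => //; last by exists s.
  by apply: finite_conv_hull_closed; exact: finite_setIl.
by lra.
Qed.

(** On conv (S and the slice), 1 + setdist C is maximal at e only, where C is the
hull of the points of S in the slice other than e; a point of P dominating e
must therefore be e. *)
Lemma dominated_extreme_points P S b e : finite_set S ->
  (forall f, convex_in I f -> dominated f P S) ->
  (forall f, convex_in I f -> dominated f S P) ->
  extreme_points (S `&` slice I b) e -> P e.
Proof.
move=> S_fin PS SP /extreme_pointsP[[Se be]]; set A := S `&` slice I b => nTe.
pose C := conv_hull (A `\ e).
have cC : convex_set C by exact: conv_hull_convex.
(* The constant 1 makes the function vanish only off the slice, which forces the
   dominating point of P onto the slice even when C is empty. *)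
have [p Pp] := SP _ (convex_in_extend0 (I := I) b (convex_setdist1 cC)) e Se.
rewrite extend0_in//; have de := setdist_ge0 C e.
have [bp|nbp] := pselect (slice I b p); last by rewrite extend0_out//; lra.
rewrite extend0_in// => dep.
have Ap : conv_hull A p.
  rewrite /A -(slice_eq bp).
  exact: (dominated_mem_conv_hull S_fin PS Pp).
have AE : A = e |` (A `\ e).
  apply/seteqP; split=> [w Aw|w [->//|[]//]].
  by have [->|/eqP we] := eqVneq w e; [left|right].
suff <- : p = e by [].
have [T0|/set0P T0] := eqVneq (A `\ e) set0.
  move: Ap; rewrite AE T0 setU0 conv_hull_id//; exact: convex_set1.
move: Ap; rewrite AE conv_hull_setU1// => -[[a q] /= [a01 Cq] pE].
have dC : 0 < setdist C e.
  apply: setdist_gt0 => //; last first.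
    by case: T0 => z Tz; exists z; exact: sub_conv_hull.
  by apply: finite_conv_hull_closed; apply: finite_setD; exact: finite_setIl.
have /convex_functionP/(_ e q a Logic.I Logic.I a01) := setdist_convex cC.
rewrite pE (setdist_mem (C := C) Cq) mulr0 addr0 => dpe.
have : a = 1.
  apply/eqP; rewrite eq_le; apply/andP; split; first by lra.
  rewrite -(ler_pM2r dC) mul1r; lra.
by move=> a1; rewrite -pE a1 subrr scale0r addr0 scale1r.
Qed.

Lemma dominated_rectangular_decomposition P S : finite_set S ->
  (forall f, convex_in I f -> dominated f P S) ->
  (forall f, convex_in I f -> dominated f S P) ->
  rectangular_decomposition I P.
Proof.
move=> S_fin PS SP; have /finite_seqP[s SE] := S_fin.
pose b (j : 'I_(size s)) := nth 0 s j.
have Sb j : S (b j) by rewrite SE; exact: mem_nth.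
pose A j := S `&` slice I (b j).
have fA j : finite_set (A j) by exact: finite_setIl.
have Ab j : conv_hull (A j) (b j) by apply: sub_conv_hull; split.
have hA j : conv_hull (conv_hull (A j)) = conv_hull (A j).
  by rewrite conv_hull_id//; exact: conv_hull_convex.
exists 'I_(size s), (fun j => conv_hull (A j)); split.
- by move=> j; exact: compact_conv_hull.
- move=> j i iI; rewrite (_ : coord_proj i _ = [set b j ord0 i]).
    exact: has_dim_set1.
  apply/seteqP; split=> [_ [x Ax <-]|_ ->]; last by exists (b j).
  have : conv_hull (A j) `<=` slice I (b j).
    by apply: conv_hull_min; [exact: slice_convex|move=> y []].
  by move=> /(_ x Ax i iI).
- move=> x [j _]; rewrite (extreme_points_hull (hA j)).
  exact: dominated_extreme_points.
- move=> x Px; have hx := dominated_mem_conv_hull S_fin PS Px.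
  have [y [Sy xy]] := conv_hull_nonempty hx.
  move: (Sy); rewrite SE => /(nthP 0)[k ks ky].
  exists (Ordinal ks) => //; rewrite /A /b /= ky.
  by rewrite (slice_eq xy).
- move=> j; rewrite hA; have /finite_seqP[r rE] := fA j.
  pose pt (k : 'I_(size r)) := nth 0 r k.
  exists 'I_(size r), pt, pt.
  split=> [//|]; congr conv_hull; rewrite rE.
  apply/seteqP; split=> [x /= /(nthP 0)[k kr <-]|x [k _]].
    by exists (Ordinal kr) => //; rewrite hyper_rect_degenerate.
  by rewrite hyper_rect_degenerate => ->; exact: mem_nth.
Qed.

End Directions.

Theorem corollary1 (R : realType) (n : nat) (n_gt0 : (0 < n)%N)
    (P : set 'rV[R]_n) (P_compact : compact P) (I : {set 'I_n}) :
  DD_representable I P <-> rectangular_decomposition I P.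
Proof.
split=> [/DD_representableP[D HD]|]; last exact: rectangular_decomposition_DD.
by apply: (dominated_rectangular_decomposition (finite_Sol D)) => f /HD[].
Qed.
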